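(* Let $\mathcal D\subset\{1,\dots,K\}$ be the (nonempty) set of domain Markov states, let $t$ be a lag time, let $C^{S}(t)$ and $C^{S}(0)$ be the stopped-process correlation matrices, and let $(C^{S}(t)-C^{S}(0))^{\mathcal D}$ denote the matrix $C^{S}(t)-C^{S}(0)$ restricted to rows and columns with indices in $\mathcal D$. Let $(Y_{lt})_{l\ge 0}$ be the Markov chain on $\{1,\dots,K\}$ with one-step transition matrix $T^{S}(t)$ and initial distribution $\mathbb P(Y_0=i)=\mu_i$. Then the induced matrix $1$-norm satisfies $$\left\|\left(C^{S}(t)-C^{S}(0)\right)^{\mathcal D}\right\|_1=\max_{j\in\mathcal D}\Big[\mathbb P\left(Y_0\in\mathcal D,\ Y_0\neq j,\ Y_t=j\right)+\mathbb P\left(Y_0=j,\ Y_t\neq j\right)\Big].$$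
   Context: Setting. $(X_s)$ is a time-homogeneous discrete-time Markov process on a phase space, taking a step every $\Delta t$ time units; lag times $t$ are positive integer multiples of $\Delta t$. The phase space is partitioned into finitely many disjoint (measurable) sets $S_1,\dots,S_K$, called Markov states. A subset $D$ of phase space (the domain) is fixed, with complement $D^c$ (the boundary states), and each $S_i$ is wholly contained in $D$ or in $D^c$; $\mathcal D$ is the set of indices $i$ with $S_i\subset D$. Let $\tau_{D^c}$ be the first time $s\ge 0$ at which $X_s\in D^c$, and $t\wedge\tau_{D^c}=\min\{t,\tau_{D^c}\}$. The stopped transition operator is $$\mathcal K^{t}_{D^c}f(x)=\mathbb E\left[f(X_{t\wedge\tau_{D^c}})\mid X_0=x\right].$$ Let $\mu$ be a probability density on phase space (the sampling measure), with $\mu_i=\int \mathbb 1_{S_i}(x)\mu(x)\,dx>0$ for every $i$. The stopped-process correlation matrices are $$C^{S}_{ij}(t)=\int \mathbb 1_{S_i}(x)\,\mathcal K^{t}_{D^c}\mathbb 1_{S_j}(x)\,\mu(x)\,dx,\qquad C^{S}_{ij}(0)=\mu_i\delta_{ij},$$ and the stopped-process transition matrix is $T^{S}_{ij}(t)=C^{S}_{ij}(t)/\mu_i$, which is a stochastic matrix. In particular, states with index outside $\mathcal D$ are absorbing for $T^{S}(t)$. The induced matrix $1$-norm is $\|A\|_1=\max_{\|v\|_1=1}\|Av\|_1$, where $\|v\|_1=\sum_i|v_i|$. *)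

(* Defs.v *)
From HB Require Import structures.
From mathcomp Require Export all_boot all_order all_algebra.
From mathcomp Require Export all_classical all_reals all_analysis.

Set Implicit Arguments.
Unset Strict Implicit.
Unset Printing Implicit Defensive.

Import Order.TTheory GRing.Theory Num.Theory.
Import numFieldNormedType.Exports.

Local Open Scope classical_set_scope.
Local Open Scope ring_scope.

(* Times are counted in steps: [X k] is the state of the process at physical
   time k * Delta t, and the lag time t = n * Delta t is represented by n. *)

(* Events generated by X_0, ..., X_n. *)
Definition past d (T : measurableType d) (Omega : Type)
    (X : nat -> Omega -> T) (n : nat) : set (set Omega) :=
  <<s [set E | exists k (B : set T),
         [/\ (k <= n)%N, measurable B & E = X k @^-1` B]] >>.

(* Time-homogeneous Markov process with transition kernel [p].  [Px x] is the
   law of the process conditioned on X_0 = x, so that expectations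
   E[ . | X_0 = x] are defined for every x and not only almost everywhere. *)
Definition markov_process d dO (T : measurableType d)
    (Omega : measurableType dO) (R : realType)
    (p : R.-pker T ~> T) (Px : R.-pker T ~> Omega)
    (X : nat -> Omega -> T) : Prop :=
  [/\ forall k, measurable_fun [set: Omega] (X k),
      forall x (B : set T), measurable B -> Px x (X 0%N @^-1` B) = \d_x B &
      forall x n (H : set Omega) (B : set T), past X n H -> measurable B ->
        Px x (H `&` X n.+1 @^-1` B) = (\int[Px x]_(w in H) p (X n w) B)%E].

(* First time s >= 0 at which the trajectory [u] is in [A]; [None] stands for
   an infinite hitting time. *)
Definition hitting_time (T : Type) (A : set T) (u : nat -> T) : option nat :=
  if pselect (exists s, `[< A (u s) >]) is left e
  then Some (ex_minn e) else None.

(* n /\ tau *)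
Definition stopped_time (n : nat) (tau : option nat) : nat :=
  if tau is Some s then minn n s else n.

(* The stopped transition operator K^n_A f(x) = E[f(X_{n /\ tau_A}) | X_0 = x]. *)
Definition stopped_op d dO (T : measurableType d)
    (Omega : measurableType dO) (R : realType) (Px : R.-pker T ~> Omega)
    (X : nat -> Omega -> T) (A : set T) (n : nat) (f : T -> R) (x : T) : R :=
  \int[Px x]_w f (X (stopped_time n (hitting_time A (X ^~ w))) w).

Definition prob_density d (T : measurableType d) (R : realType)
    (lam : {measure set T -> \bar R}) (mu : T -> R) : Prop :=
  [/\ measurable_fun [set: T] mu, forall x, 0 <= mu x &
      (\int[lam]_x (mu x)%:E = 1)%E].

Definition markov_partition d (T : measurableType d) (K : nat)
    (S : 'I_K -> set T) : Prop :=
  [/\ forall i, measurable (S i), trivIset [set: 'I_K] S &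
      \bigcup_i S i = [set: T]].

Definition state_weight d (T : measurableType d) (R : realType) (K : nat)
    (lam : {measure set T -> \bar R}) (mu : T -> R) (S : 'I_K -> set T)
    (i : 'I_K) : R :=
  \int[lam]_x (\1_(S i) x * mu x).

(* C^S(t) at a positive lag time t. *)
Definition stopped_corr d dO (T : measurableType d)
    (Omega : measurableType dO) (R : realType) (K : nat)
    (lam : {measure set T -> \bar R}) (mu : T -> R)
    (Px : R.-pker T ~> Omega) (X : nat -> Omega -> T)
    (D : set T) (S : 'I_K -> set T) (n : nat) : 'M[R]_K :=
  \matrix_(i, j)
    \int[lam]_x (\1_(S i) x * stopped_op Px X (~` D) n \1_(S j) x * mu x).

(* C^S(0). *)
Definition stopped_corr0 d (T : measurableType d) (R : realType) (K : nat)
    (lam : {measure set T -> \bar R}) (mu : T -> R) (S : 'I_K -> set T) :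
    'M[R]_K :=
  \matrix_(i, j) (state_weight lam mu S i * (i == j)%:R).

Definition stopped_trans d dO (T : measurableType d)
    (Omega : measurableType dO) (R : realType) (K : nat)
    (lam : {measure set T -> \bar R}) (mu : T -> R)
    (Px : R.-pker T ~> Omega) (X : nat -> Omega -> T)
    (D : set T) (S : 'I_K -> set T) (n : nat) : 'M[R]_K :=
  \matrix_(i, j)
    (stopped_corr lam mu Px X D S n i j / state_weight lam mu S i).

Definition domain_states (T : Type) (K : nat) (D : set T)
    (S : 'I_K -> set T) : {set 'I_K} :=
  [set i | `[< S i `<=` D >]]%SET.

Definition restrict_mx (R : Type) (K : nat) (I : {set 'I_K}) (A : 'M[R]_K) :
    'M[R]_#|I| :=
  mxsub enum_val enum_val A.

Definition norm1 (R : realType) (m : nat) (v : 'cV[R]_m) : R :=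
  \sum_i `|v i 0|.

(* The supremum over the unit sphere is attained, the sphere being compact. *)
Definition opnorm1 (R : realType) (m n : nat) (A : 'M[R]_(m, n)) : R :=
  sup [set norm1 (A *m v) | v in [set v : 'cV[R]_n | norm1 v = 1]].

Definition cond_prob d (Omega : measurableType d) (R : realType)
    (Q : probability Omega R) (A H : set Omega) : R :=
  fine (Q (A `&` H)) / fine (Q H).

Definition markov_chain d (Omega : measurableType d) (R : realType) (K : nat)
    (Q : probability Omega R) (Y : nat -> Omega -> 'I_K)
    (init : 'I_K -> R) (M : 'M[R]_K) : Prop :=
  [/\ forall l i, measurable (Y l @^-1` [set i]),
      forall i, Q (Y 0%N @^-1` [set i]) = (init i)%:E &
      forall l (h : nat -> 'I_K) (j : 'I_K),
        let H := [set w | forall k, (k <= l)%N -> Y k w = h k] in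
        (0 < Q H)%E ->
        cond_prob Q (Y l.+1 @^-1` [set j]) H = M (h l) j].

(* Main.v *)
(** The 1-norm of a matrix is its largest absolute column sum.  Since
    [C^S(t)_(i,j) = P(Y_0 = i, Y_t = j)], the column sum at [j] of
    [(C^S(t) - C^S(0))^D] splits into its off-diagonal part
    [P(Y_0 in D, Y_0 != j, Y_t = j)] and its diagonal entry, which is
    [P(Y_0 = j, Y_t = j) - P(Y_0 = j) = - P(Y_0 = j, Y_t != j)]. *)

Require Import Defs.
From mathcomp Require Import all_boot all_order all_algebra.
From mathcomp Require Import all_classical all_reals all_analysis.

Set Implicit Arguments.
Unset Strict Implicit.
Unset Printing Implicit Defensive.

Import Order.TTheory GRing.Theory Num.Theory.
Import numFieldNormedType.Exports.

Local Open Scope classical_set_scope.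
Local Open Scope ring_scope.

Lemma norm1_ge0 (R : realType) (m : nat) (v : 'cV[R]_m) : 0 <= norm1 v.
Proof. by apply: sumr_ge0 => i _; apply: normr_ge0. Qed.

Lemma norm1_delta_mx (R : realType) (m : nat) (j : 'I_m) :
  norm1 (delta_mx j 0 : 'cV[R]_m) = 1.
Proof.
rewrite /norm1 (bigD1 j) //= mxE !eqxx normr1 big1 ?addr0 // => i ij.
by rewrite mxE (negbTE ij) normr0.
Qed.

(** Triangle inequality on each row, then exchange of the two sums, so that each [|v j 0|] is
    weighted by the norm of column [j]. *)
Lemma norm1_mulmx_le (R : realType) (m n : nat) (A : 'M[R]_(m, n))
    (c : R) (v : 'cV[R]_n) :
  (forall j, norm1 (col j A) <= c) -> norm1 (A *m v) <= c * norm1 v.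
Proof.
move=> Ac; rewrite /norm1.
apply: (@le_trans _ _ (\sum_i \sum_j `|A i j| * `|v j 0|)).
  apply: ler_sum => i _; rewrite mxE; apply: le_trans (ler_norm_sum _ _ _) _.
  by apply: ler_sum => j _; rewrite normrM.
rewrite exchange_big mulr_sumr; apply: ler_sum => j _.
rewrite -mulr_suml ler_wpM2r //; apply: le_trans (Ac j).
by apply: ler_sum => i _; rewrite mxE.
Qed.

(** The largest column norm bounds the supremum, and each column norm is reached at a unit basis
    vector, which [A] sends to that column. *)
Lemma opnorm1_max_col (R : realType) (m n : nat) (A : 'M[R]_(m, n)) :
  opnorm1 A = \big[Num.max/0]_j norm1 (col j A).
Proof.
rewrite /opnorm1; set E := (X in sup X).
set c := \big[_/_]_j _.
have ubE : ubound E c.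
  move=> _ [v v1 <-]; rewrite -[c]mulr1 -v1; apply: norm1_mulmx_le => j.
  exact: le_bigmax.
have colIn j : E (norm1 (col j A)).
  exists (delta_mx j 0); first exact: norm1_delta_mx.
  by rewrite colE.
have col_sup j : norm1 (col j A) <= sup E.
  by apply: ub_le_sup; [exists c | exact: colIn].
case: (pickP (@predT 'I_n)) => [j0 _ | n0].
  apply/le_anti/andP; split.
    by apply: ge_sup => //; exists (norm1 (col j0 A)); exact: colIn.
  (* The maximum starts from 0, so [0 <= sup E] is required too; the column [j0] provides it. *)
  apply: bigmax_le => [|j _]; last exact: col_sup.
  by apply: le_trans (col_sup j0); exact: norm1_ge0.
(* With no columns the unit sphere is empty, and [sup set0 = 0]. *)
rewrite /c big_pred0 // (_ : E = set0) ?sup0 // -subset0 => _ [v v1 <-].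
by move: v1 => /=; rewrite /norm1 big_pred0 // => /esym/eqP; rewrite oner_eq0.
Qed.

Lemma opnorm1_restrict_mx (R : realType) (K : nat) (I : {set 'I_K})
    (A : 'M[R]_K) :
  opnorm1 (restrict_mx I A) = \big[Num.max/0]_(j in I) \sum_(i in I) `|A i j|.
Proof.
have norm1_colE k : norm1 (col k (restrict_mx I A)) =
    \sum_(i in I) `|A i (enum_val k)|.
  by rewrite big_enum_val; apply: eq_bigr => i _; rewrite !mxE.
rewrite opnorm1_max_col; apply/le_anti/andP; split.
  apply: bigmax_le => [|k _]; first exact: bigmax_ge_id.
  by rewrite norm1_colE; apply: (@le_bigmax_cond _ _ _ _ (enum_val k) (mem I)
    (fun j => \sum_(i in I) `|A i j|)); exact: enum_valP.
apply: bigmax_le => [|j jI]; first exact: bigmax_ge_id.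
(* Writing [j] as [enum_val] of its rank turns the sum into a column norm of the restricted
   matrix. *)
rewrite -[j in leLHS](enum_rankK_in jI jI) -norm1_colE.
exact: (@le_bigmax _ _ _ _ (fun k => norm1 (col k (restrict_mx I A)))).
Qed.

(** Finite additivity over the disjoint fibers of [Z]; it turns a column sum of joint probabilities
    into the probability of one event. *)
Lemma fine_measure_sum_fiber d (Omega : measurableType d) (R : realType)
    (K : nat) (Q : probability Omega R) (Z : Omega -> 'I_K) (P : pred 'I_K)
    (B : set Omega) :
  measurable B -> (forall i, measurable (Z @^-1` [set i])) ->
  fine (Q [set w | P (Z w) /\ B w]) =
  \sum_(i | P i) fine (Q (B `&` Z @^-1` [set i])).
Proof.
move=> mB mZ.
have mBZ i : measurable (B `&` Z @^-1` [set i]) by exact: measurableI.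
rewrite sum_fine => [|i _]; last exact: fin_num_measure.
rewrite -measure_bigsetU_ord //; last first.
  apply/trivIsetP => i j _ _ /eqP ij; rewrite -subset0 => w.
  by move=> [[_ /= Zi] [_ /= Zj]]; apply: ij; rewrite -Zi.
congr (fine (Q _)); rewrite -bigcup_seq_cond; apply/seteqP; split => w /=.
  by case=> Pw Bw; exists (Z w) => //=; rewrite mem_index_enum.
by case=> i /= /andP[_ Pi] [Bw ->].
Qed.

Lemma markov_chain_joint d (Omega : measurableType d) (R : realType) (K : nat)
    (Q : probability Omega R) (Y : nat -> Omega -> 'I_K)
    (init : 'I_K -> R) (M : 'M[R]_K) (i j : 'I_K) :
  markov_chain Q Y init M -> 0 < init i ->
  fine (Q (Y 1%N @^-1` [set j] `&` Y 0%N @^-1` [set i])) = init i * M i j.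
Proof.
move=> [_ Qinit step] i_gt0.
(* At time 0 only [h 0] matters, so a constant history makes the conditioning event [Y 0 = i]. *)
have := step 0%N (fun=> i) j.
rewrite (_ : [set w | _] = Y 0%N @^-1` [set i]); last first.
  apply/seteqP; split => w /=; first by apply.
  by move=> Yi k; rewrite leqn0 => /eqP ->.
rewrite /cond_prob Qinit lte_fin /= => /(_ i_gt0) <-.
by rewrite mulrC divfK // gt_eqF.
Qed.

Theorem mainTheorem1 (R : realType) (d dO dQ : measure_display)
    (T : measurableType d) (Omega : measurableType dO)
    (OmegaY : measurableType dQ)
    (* the process X, reference measure dx = lam, sampling density mu *)
    (p : R.-pker T ~> T) (Px : R.-pker T ~> Omega) (X : nat -> Omega -> T)
    (lam : {measure set T -> \bar R}) (mu : T -> R)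
    (* domain and Markov states *)
    (D : set T) (K : nat) (S : 'I_K -> set T)
    (* lag time t = n * Delta t *)
    (n : nat)
    (* the chain Y: Y l is the state at time l * t *)
    (Q : probability OmegaY R) (Y : nat -> OmegaY -> 'I_K)
    (hX : markov_process p Px X)
    (hmu : prob_density lam mu)
    (hS : markov_partition S)
    (hSD : forall i, S i `<=` D \/ S i `<=` ~` D)
    (hmupos : forall i, 0 < state_weight lam mu S i)
    (hD : domain_states D S != finset.set0)
    (hn : (0 < n)%N)
    (hY : markov_chain Q Y (state_weight lam mu S)
            (stopped_trans lam mu Px X D S n)) :
  opnorm1 (restrict_mx (domain_states D S)
             (stopped_corr lam mu Px X D S n - stopped_corr0 lam mu S)) =
  \big[Num.max/0]_(j in domain_states D S)
     (fine (Q [set w | [/\ Y 0%N w \in domain_states D S,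
                           Y 0%N w <> j & Y 1%N w = j]])
      + fine (Q [set w | Y 0%N w = j /\ Y 1%N w <> j])).
Proof.
have [mY Qinit _] := hY.
set w := state_weight lam mu S in hY hmupos Qinit *.
set C := stopped_corr lam mu Px X D S n.
(* The initial weight [w i] cancels the normalisation of row [i] in [stopped_trans]. *)
have CE i j : C i j = fine (Q (Y 1%N @^-1` [set j] `&` Y 0%N @^-1` [set i])).
  by rewrite (markov_chain_joint _ hY) // [in RHS]mxE mulrC divfK // gt_eqF.
have diffE i j : (C - stopped_corr0 lam mu S) i j = C i j - w i * (i == j)%:R.
  by rewrite mxE; congr (_ + _); rewrite !mxE.
rewrite opnorm1_restrict_mx; apply: eq_bigr => j jD.
rewrite (bigD1 j jD) /= addrC; congr (_ + _).
  rewrite (_ : [set w | _] = [set w | (Y 0%N w \in domain_states D S) &&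
      (Y 0%N w != j) /\ (Y 1%N @^-1` [set j]) w]); last first.
    apply/seteqP; split => x /=.
      by move=> [-> /eqP-> ->].
    by move=> [/andP[-> /eqP ?] ->].
  rewrite (@fine_measure_sum_fiber _ _ _ _ Q (Y 0%N)
    (fun i => (i \in domain_states D S) && (i != j))) //.
  apply: eq_bigr => i /andP[_ ij].
  by rewrite diffE (negbTE ij) mulr0 subr0 CE ger0_norm ?fine_ge0.
have mI : measurable (Y 1%N @^-1` [set j] `&` Y 0%N @^-1` [set j]).
  exact: measurableI.
have mD : measurable (Y 0%N @^-1` [set j] `\` Y 1%N @^-1` [set j]).
  exact: measurableD.
have -> : [set x | Y 0%N x = j /\ Y 1%N x <> j] =
    Y 0%N @^-1` [set j] `\` Y 1%N @^-1` [set j] by [].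
(* Splitting [Y 0 = j] by whether [Y 1 = j] shows that the diagonal entry is minus a probability,
   hence the sign change under the absolute value. *)
have wE : w j = fine (Q (Y 0%N @^-1` [set j] `\` Y 1%N @^-1` [set j])) + C j j.
  rewrite -[w j]/(fine (w j)%:E) -Qinit CE -fineD ?fin_num_measure //.
  by congr fine; rewrite [X in (_ + Q X)%E]setIC; apply: measureDI.
rewrite diffE eqxx mulr1 wE.
by rewrite opprD addrCA subrr addr0 normrN ger0_norm ?fine_ge0.
Qed.
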